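(* Consider the infinite-driver-patience regime ($\beta=0$) of the monopoly problem, i.e. the maximization of $\phi\mapsto\mathcal M(\phi;0)$ over $\phi\in[0,\phi_h]$. Define $$d_m(\phi):=f(\phi)+\phi f'(\phi),\qquad \phi_m:=\max\{\phi\in[0,\phi_h]: d_m(\phi)\ge 0\}.$$ Then: (1) if $\rho\le f(\phi_m)/2$, then $f^{-1}(2\rho)$ is the unique maximizer of $\mathcal M(\cdot;0)$ over $[0,\phi_h]$; (2) if $\rho> f(\phi_m)/2$, then $\phi_m$ is the unique maximizer of $\mathcal M(\cdot;0)$ over $[0,\phi_h]$. In particular the optimal monopoly price is a non-increasing function of $\rho$. Moreover, for any sequence $\beta_n\to 0$ with $\beta_n>0$ and any corresponding sequence of optimal prices $\phi_n^*\in\arg\max_{\phi\in[0,\phi_h]}\mathcal M(\phi;\beta_n)$, there exists a subsequence of $(\phi_n^* )$ that converges to the unique optimal price of the regime $\beta=0$.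
   Context: Fix $\phi_h>0$ and $f:[0,\phi_h]\to\mathbb R$ that is strictly concave, strictly decreasing and differentiable, with $0<f(\phi)\le 1$ for all $\phi\in[0,\phi_h]$ and $f(0)=1$. Fix $\Lambda>0$ (total passenger arrival rate) and $e>0$ (effective driver arrival rate), and let $\rho:=e/\Lambda$. The extended inverse $f^{-1}:[0,\infty)\to[0,\phi_h]$ is: $f^{-1}(x)=\phi_h$ for $0\le x<f(\phi_h)$; $f^{-1}(x)$ is the unique $\phi$ with $f(\phi)=x$ for $f(\phi_h)\le x\le 1$; $f^{-1}(x)=0$ for $x>1$. A monopolistic platform sees passengers at rate $\Lambda/2$. For price $\phi\in[0,\phi_h]$ and driver abandonment rate $\beta>0$, the driver-unavailability probability is $$\mathcal U(\phi;\beta)=\Big(\sum_{n=0}^\infty \frac{e^n}{\prod_{a=1}^n(\frac{\Lambda}{2} f(\phi)+a\beta)}\Big)^{-1}$$ (here $e^n$ is the $n$-th power of the parameter $e$, and empty products are $1$), and the platform's revenue rate is $\mathcal M(\phi;\beta)=\frac{\Lambda}{2}f(\phi)\,\phi\,(1-\mathcal U(\phi;\beta))$. For $\beta=0$, $\mathcal M(\phi;0)$ is the pointwise limit of $\mathcal M(\phi;\beta)$ as $\beta\downarrow0$: $\mathcal M(\phi;0)=e\phi$ if $f(\phi)>2\rho$, and $\mathcal M(\phi;0)=\frac{\Lambda}{2}f(\phi)\phi$ otherwise. *)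

(* Defs.v *)
From HB Require Import structures.
From mathcomp Require Import all_boot all_order all_algebra.
From mathcomp Require Import all_classical all_reals all_analysis.

Set Implicit Arguments.
Unset Strict Implicit.
Unset Printing Implicit Defensive.

Import Order.TTheory GRing.Theory Num.Theory.
Import numFieldNormedType.Exports.

Local Open Scope classical_set_scope.
Local Open Scope ring_scope.

Definition argmax (T : Type) (R : realType) (A : set T) (g : T -> R) : set T :=
  [set x | A x /\ forall y, A y -> g y <= g x].

(* The difference quotient is restricted to D, so that on a segment the
   derivative is one-sided at the endpoints and the values of f outside the
   segment are irrelevant. *)
Definition derivable_within (R : realType) (D : set R) (f : R -> R) (x : R) :=
  cvg ((f y - f x) / (y - x) @[y --> within D x^']).

Definition derive_within (R : realType) (D : set R) (f : R -> R) (x : R) : R :=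
  lim ((f y - f x) / (y - x) @[y --> within D x^']).

Definition strictly_concave_on (R : realType) (D : set R) (f : R -> R) :=
  forall x y t : R, D x -> D y -> x != y -> 0 < t < 1 ->
    t * f x + (1 - t) * f y < f (t * x + (1 - t) * y).

Section Monopoly.
Variables (R : realType) (phi_h : R) (f : R -> R).

(* The default value 0 of xget is never used for f phi_h <= x <= 1 when f is
   continuous with f 0 = 1; uniqueness of the preimage comes from strict
   monotonicity. *)
Definition ext_inverse (x : R) : R :=
  if x < f phi_h then phi_h
  else if 1 < x then 0
  else xget 0 [set phi | phi \in `[0, phi_h] /\ f phi = x].

Definition d_m (phi : R) : R :=
  f phi + phi * derive_within `[0, phi_h]%classic f phi.

Definition d_m_nonneg : set R :=
  [set phi | phi \in `[0, phi_h] /\ 0 <= d_m phi].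

Variables (Lambda e : R).

(* A real-valued series; for f phi, Lambda, e, beta > 0 it converges, with
   first term 1. *)
Definition unavailability (phi beta : R) : R :=
  (limn (series (fun n =>
     e ^+ n / \prod_(1 <= a < n.+1) (Lambda / 2 * f phi + a%:R * beta))))^-1.

Definition revenue (phi beta : R) : R :=
  Lambda / 2 * f phi * phi * (1 - unavailability phi beta).

Definition revenue0 (phi : R) : R :=
  if 2 * (e / Lambda) < f phi then e * phi else Lambda / 2 * f phi * phi.

End Monopoly.

(* Main.v *)
(* Write [mu = Lambda / 2 * f phi]. The balance inequality [mu * (1 - U) <= e]
   together with [U >= 0] shows that the revenue at [beta > 0] never exceeds
   [min (e * phi) (mu * phi)], its value at [beta = 0]; bounding the series
   below by its partial sums shows that this bound is attained in the limit.
   Since [phi * f phi] is strictly concave with maximizer [phi_m], the limit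
   revenue is the minimum of an increasing linear function and a strictly
   concave one: its maximizer is the crossing point [f phi = 2 * rho] if that
   lies to the right of [phi_m], and [phi_m] otherwise. As the limit revenue is
   quasi-concave, prices at a distance [eps] from its maximizer are bounded away
   from the optimal value; since the revenues at [beta_n] lie below it and
   converge to it at the maximizer, the whole sequence of optimal prices
   converges, with no extraction of a subsequence. *)
Require Import Defs.
From mathcomp Require Import all_boot all_order all_algebra.
From mathcomp Require Import all_classical all_reals all_analysis.
From mathcomp Require Import ring lra.
Import Order.TTheory GRing.Theory Num.Theory.
Import numFieldNormedType.Exports.
Local Open Scope classical_set_scope.
Local Open Scope ring_scope.

(** * The series behind the unavailability probability *)

Definition queue_term {R : realType} (mu e beta : R) (n : nat) : R :=
  e ^+ n / \prod_(1 <= a < n.+1) (mu + a%:R * beta).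

Section QueueSeries.
Context {R : realType} (mu e : R).
Hypotheses (mu_gt0 : 0 < mu) (e_gt0 : 0 < e).

Lemma queue_term0 beta : queue_term mu e beta 0 = 1.
Proof. by rewrite /queue_term big_nil expr0 divr1. Qed.

Lemma queue_termS beta n :
  queue_term mu e beta n.+1
    = queue_term mu e beta n * (e / (mu + n.+1%:R * beta)).
Proof.
by rewrite /queue_term big_nat_recr //= exprSr invfM mulrACA.
Qed.

Lemma queue_rate_gt0 beta n : 0 <= beta -> 0 < mu + n%:R * beta.
Proof. by move=> b0; rewrite ltr_pwDl // mulr_ge0. Qed.

Lemma queue_term_gt0 beta n : 0 <= beta -> 0 < queue_term mu e beta n.
Proof.
move=> b0; elim: n => [|n IH]; first by rewrite queue_term0.
by rewrite queue_termS mulr_gt0 // divr_gt0 // queue_rate_gt0.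
Qed.

(** Dropping [mu] from every factor of the denominator leaves [n! * beta ^+ n], so the exponential
    series at [e / beta] dominates and yields convergence. *)
Lemma queue_term_le_exp beta n : 0 < beta ->
  queue_term mu e beta n <= exp_coeff (e / beta) n.
Proof.
move=> b0; elim: n => [|n IH].
  by rewrite queue_term0 /exp_coeff /= expr0 fact0 divr1.
have -> : exp_coeff (e / beta) n.+1
    = exp_coeff (e / beta) n * (e / (n.+1%:R * beta)).
  by rewrite /exp_coeff /= exprSr factS natrM !invfM; ring.
rewrite queue_termS ler_pM ?(ltW (queue_term_gt0 _ _ _)) ?(ltW b0) //.
  by rewrite divr_ge0 ?(ltW e_gt0) // ltW // queue_rate_gt0 // ltW.
rewrite ler_pM2l // lef_pV2 ?posrE ?queue_rate_gt0 ?(ltW b0) ?mulr_gt0 //.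
by rewrite lerDr ltW.
Qed.

Lemma cvg_queue_series beta : 0 < beta ->
  cvgn (series (queue_term mu e beta)).
Proof.
move=> b0; apply: (@series_le_cvg _ _ (exp_coeff (e / beta))) => [n|n|n|].
- by rewrite ltW // queue_term_gt0 // ltW.
- by rewrite exp_coeff_ge0 // divr_ge0 // ltW.
- exact: queue_term_le_exp.
- exact: is_cvg_series_exp_coeff.
Qed.

Lemma queue_series_le_lim beta n : 0 < beta ->
  series (queue_term mu e beta) n <= limn (series (queue_term mu e beta)).
Proof.
move=> b0; apply: nondecreasing_cvgn_le; last exact: cvg_queue_series.
apply/nondecreasing_seqP => k; rewrite /series /= big_nat_recr //= lerDl.
by rewrite ltW // queue_term_gt0 // ltW.
Qed.

Lemma queue_series_ge1 beta n : 0 <= beta ->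
  1 <= series (queue_term mu e beta) n.+1.
Proof.
move=> b0; rewrite /series /= big_nat_recl //= queue_term0 lerDl.
by rewrite sumr_ge0 // => i _; rewrite ltW // queue_term_gt0.
Qed.

(* The balance inequality: the served flow [mu * (1 - U)], with [U] the inverse
   of the series, is at most the arrival flow [e]. *)
Lemma queue_balance beta : 0 < beta ->
  mu * (1 - (limn (series (queue_term mu e beta)))^-1) <= e.
Proof.
move=> b0; set S := limn _.
have S1 : 1 <= S.
  by apply: le_trans (queue_series_le_lim beta 1 b0);
     exact/queue_series_ge1/ltW.
have S0 : 0 < S by exact: lt_le_trans S1.
suff H : mu * (S - 1) <= e * S.
  rewrite -(@ler_pM2r _ S) // -mulrA mulrBl mul1r mulVf //.
  by rewrite gt_eqF.
(* Term by term, [mu / (mu + i.+1%:R * beta) <= 1] bounds [mu] times term [i.+1] by [e] times term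
   [i]. The empty sum is treated apart, since it lacks the leading term 1. *)
have step n : mu * (series (queue_term mu e beta) n - 1) <= e * S.
  case: n => [|n].
    rewrite /series /= big_geq // sub0r mulrN1.
    apply: (@le_trans _ _ 0); last by rewrite mulr_ge0 // ltW.
    by rewrite oppr_le0 ltW.
  rewrite /series /= big_nat_recl //= queue_term0 addrAC subrr add0r.
  apply: (@le_trans _ _ (e * series (queue_term mu e beta) n)); last first.
    by rewrite ler_pM2l // queue_series_le_lim.
  rewrite /series /= !mulr_sumr; apply: ler_sum => i _.
  rewrite queue_termS mulrCA mulrC.
  rewrite ler_pM2r ?queue_term_gt0 ?(ltW b0) // mulrCA ger_pMr //.
  rewrite ler_pdivrMr ?queue_rate_gt0 ?(ltW b0) // mul1r lerDl.
  by rewrite mulr_ge0 // ltW.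
have cvgS : mu * (series (queue_term mu e beta) n - 1) @[n --> \oo]
    --> mu * (S - 1); last by apply: (cvgr_to_le cvgS); exact: nearW.
apply: cvgM; first exact: cvg_cst.
apply: cvgB; last exact: cvg_cst.
exact: cvg_queue_series.
Qed.

Lemma cvg_queue_term n :
  queue_term mu e beta n @[beta --> 0^'+] --> geometric 1 (e / mu) n.
Proof.
elim: n => [|n IH].
  under eq_fun do rewrite queue_term0.
  by rewrite /= expr0 mulr1; exact: cvg_cst.
under eq_fun do rewrite queue_termS.
rewrite /= exprSr mulrA; apply: cvgM; first exact: IH.
apply: cvgM; first exact: cvg_cst.
apply: cvgV; first by rewrite gt_eqF.
rewrite -[X in _ --> X]addr0; apply: cvgD; first exact: cvg_cst.
rewrite -[X in _ --> X](mulr0 n.+1%:R); apply: cvgM; first exact: cvg_cst.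
exact: cvg_within.
Qed.

Lemma cvg_queue_partial_sum n :
  series (queue_term mu e beta) n @[beta --> 0^'+]
    --> series (geometric 1 (e / mu)) n.
Proof.
elim: n => [|n IH].
  by rewrite /series /= big_geq //; under eq_fun do rewrite big_geq //;
     exact: cvg_cst.
rewrite /series /= big_nat_recr //=.
under eq_fun do rewrite big_nat_recr //=.
by apply: cvgD => //; exact: cvg_queue_term.
Qed.
End QueueSeries.

(** For [1 <= x] a sum of [n.+1] terms is at least [n.+1], so its inverse lies below the harmonic
    sequence. With [x = e / mu] the limit is the unavailability to be reached as [beta] decreases to
    0. *)
Lemma cvg_inv_geometric_series {R : realType} (x : R) : 0 < x ->
  (series (geometric 1 x) n.+1)^-1 @[n --> \oo] --> Num.max 0 (1 - x).
Proof.
move=> x0; case: (ltP x 1) => [x1|x1].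
  rewrite max_r ?subr_ge0 ?ltW //.
  have normx : `|x| < 1 by rewrite ger0_norm // ltW.
  rewrite -(invrK (1 - x)); apply: cvgV.
    by rewrite invr_eq0 subr_eq0 gt_eqF.
  rewrite -[X in _ --> X]mul1r cvg_shiftS.
  exact: cvg_geometric_series.
rewrite max_l ?subr_le0 //.
apply: (@squeeze_cvgr _ _ _ _ (fun=> 0) harmonic); last exact: cvg_harmonic.
  apply: nearW => n.
  have H : n.+1%:R <= series (geometric 1 x) n.+1.
    rewrite /series /= -[X in X%:R <= _]subn0 -sumr_const_nat.
    apply: ler_sum => i _.
    by rewrite mul1r exprn_ege1.
  rewrite invr_ge0 (le_trans _ H) //= lef_pV2 ?posrE //.
  exact: lt_le_trans H.
exact: cvg_cst.
Qed.

(** * Limits and bounds of the unavailability and of the revenue *)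

Section Unavailability.
Context {R : realType} (f : R -> R) (Lambda e phi : R).
Hypotheses (Lambda_gt0 : 0 < Lambda) (e_gt0 : 0 < e) (f_gt0 : 0 < f phi).

Let mu_gt0 : 0 < Lambda / 2 * f phi.
Proof. by rewrite mulr_gt0 // divr_gt0. Qed.

Lemma unavailability_ge0 beta : 0 < beta ->
  0 <= unavailability f Lambda e phi beta.
Proof.
move=> b0; have := queue_series_le_lim _ _ mu_gt0 e_gt0 _ 0 b0.
rewrite invr_ge0; apply: le_trans.
by rewrite /series /= big_geq.
Qed.

Lemma unavailability_le beta n : 0 < beta ->
  unavailability f Lambda e phi beta
    <= (series (queue_term (Lambda / 2 * f phi) e beta) n.+1)^-1.
Proof.
move=> b0; have S0 := lt_le_trans ltr01
  (queue_series_ge1 _ _ mu_gt0 e_gt0 _ n (ltW b0)).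
have H := queue_series_le_lim _ _ mu_gt0 e_gt0 _ n.+1 b0.
by rewrite lef_pV2 ?posrE // (lt_le_trans S0).
Qed.

Lemma unavailability_ge beta : 0 < beta ->
  1 - e / (Lambda / 2 * f phi) <= unavailability f Lambda e phi beta.
Proof.
move=> b0; have := queue_balance _ _ mu_gt0 e_gt0 _ b0.
rewrite -/(unavailability f Lambda e phi beta) => H.
by rewrite lerBlDr -lerBlDl ler_pdivlMr // mulrC.
Qed.

(** No interchange of limits is required: the limit [m] is a lower bound for every [beta > 0], and
    the upper bound uses a partial sum of one fixed length, chosen so that the inverse of its
    geometric limit is below [m + eps]. *)
Lemma cvg_unavailability :
  unavailability f Lambda e phi beta @[beta --> 0^'+]
    --> Num.max 0 (1 - e / (Lambda / 2 * f phi)).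
Proof.
set mu := Lambda / 2 * f phi; set m := Num.max _ _.
apply/cvgrPdist_lt => eps eps0.
have /cvgrPdist_lt/(_ _ eps0)[N _ /(_ N (leqnn N))/= HN] :=
  cvg_inv_geometric_series (e / mu) (divr_gt0 e_gt0 mu_gt0).
have S0 : series (geometric 1 (e / mu)) N.+1 != 0.
  rewrite gt_eqF // /series /= big_nat_recl //= mulr1 ltr_pwDl //.
  by rewrite sumr_ge0 // => i _; rewrite mul1r exprn_ge0 // ltW // divr_gt0.
have S_lt : (series (geometric 1 (e / mu)) N.+1)^-1 < m + eps.
  by move: HN; rewrite -/m ltr_distlC => /andP[].
have near_lt := cvgr_lt _ (cvgV S0 (cvg_queue_partial_sum mu e mu_gt0 N.+1))
  _ S_lt.
near=> beta.
have b0 : 0 < beta by [].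
have m_le : m <= unavailability f Lambda e phi beta.
  by rewrite ge_max unavailability_ge0 // unavailability_ge.
rewrite distrC ger0_norm ?subr_ge0 // ltrBlDl.
apply: le_lt_trans (unavailability_le beta N b0) _.
by near: beta; exact: near_lt.
Unshelve. all: by end_near.
Qed.

(** The threshold [2 * (e / Lambda) < f phi] says [e < Lambda / 2 * f phi], so the case distinction
    always selects the smaller of the two branches. *)
Lemma revenue0E : 0 <= phi ->
  revenue0 f Lambda e phi = Num.min (e * phi) (Lambda / 2 * f phi * phi).
Proof.
move=> phi_ge0; rewrite /revenue0.
have -> : 2 * (e / Lambda) = e / (Lambda / 2).
  by field; rewrite gt_eqF.
rewrite ltr_pdivrMr ?divr_gt0 // (mulrC (f phi)).
case: ltP => H; first by rewrite min_l // ler_wpM2r // ltW.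
by rewrite min_r // ler_wpM2r.
Qed.

Lemma cvg_revenue : 0 <= phi ->
  revenue f Lambda e phi beta @[beta --> 0^'+] --> revenue0 f Lambda e phi.
Proof.
move=> phi_ge0; rewrite (revenue0E phi_ge0).
have -> : Num.min (e * phi) (Lambda / 2 * f phi * phi)
    = Lambda / 2 * f phi * phi * (1 - Num.max 0 (1 - e / (Lambda / 2 * f phi))).
  set mu := Lambda / 2 * f phi; have mu0 : 0 < mu := mu_gt0.
  case: (leP e mu) => He.
    rewrite max_r ?subr_ge0 ?ler_pdivrMr ?mul1r // min_l ?ler_wpM2r //.
    by rewrite subKr mulrAC [mu * _]mulrC divfK ?gt_eqF.
  rewrite max_l ?subr_le0 ?ler_pdivlMr ?mul1r ?(ltW He) // subr0 mulr1.
  by rewrite min_r // ler_wpM2r // ltW.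
apply: cvgM; first exact: cvg_cst.
apply: cvgB; first exact: cvg_cst.
exact: cvg_unavailability.
Qed.

Lemma revenue_le_revenue0 beta : 0 <= phi -> 0 < beta ->
  revenue f Lambda e phi beta <= revenue0 f Lambda e phi.
Proof.
move=> phi_ge0 b0; rewrite revenue0E // /revenue le_min; apply/andP; split.
  rewrite mulrAC ler_wpM2r //.
  exact: queue_balance _ _ mu_gt0 e_gt0 _ b0.
apply: ler_piMr; first by rewrite mulr_ge0 // ltW.
by rewrite gerBl unavailability_ge0.
Qed.
End Unavailability.

(** * Strict concavity of the gross revenue and its maximizer *)

Lemma strictly_concave_min_lt {R : realType} (D : set R) (g : R -> R)
    (a z b : R) :
  strictly_concave_on D g -> D a -> D b -> a < z < b ->
  Num.min (g a) (g b) < g z.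
Proof.
move=> gD Da Db /andP[az zb]; have ab := lt_trans az zb.
pose t := (b - z) / (b - a).
have tE : t * a + (1 - t) * b = z by rewrite /t; field; rewrite subr_eq0 gt_eqF.
have t01 : 0 < t < 1.
  by rewrite divr_gt0 ?subr_gt0 //= ltr_pdivrMr ?subr_gt0 // mul1r ltrD2l ltrN2.
have := gD a b t Da Db (negbT (lt_eqF ab)) t01; rewrite tE; apply: le_lt_trans.
have /andP[t0 t1] := t01.
set m := Num.min _ _.
have ma : m <= g a by rewrite ge_min lexx.
have mb : m <= g b by rewrite ge_min lexx orbT.
nra.
Qed.

Definition gross_revenue {R : realType} (f : R -> R) (x : R) : R := x * f x.

Section Revenue.
Context {R : realType} (phi_h : R) (f : R -> R).
Hypotheses (phi_h_gt0 : 0 < phi_h)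
  (f_concave : strictly_concave_on `[0, phi_h]%classic f)
  (f_decreasing : forall x y : R, x \in `[0, phi_h] -> y \in `[0, phi_h] ->
     x < y -> f y < f x)
  (f_derivable : forall x : R, x \in `[0, phi_h] ->
     derivable_within `[0, phi_h]%classic f x)
  (f_range : forall x : R, x \in `[0, phi_h] -> 0 < f x <= 1)
  (f_at0 : f 0 = 1).

Local Notation g := (gross_revenue f).

(** The increment of [f] is its convergent difference quotient times [y - x], which tends to 0. *)
Lemma continuous_within_demand : {within `[0, phi_h], continuous f}.
Proof.
apply/subspace_continuousP => x Dx; apply/cvgrPdist_lt => eps eps0.
have fx := f_derivable x Dx.
have cvg_diff : (f y - f x) / (y - x) * (y - x)
    @[y --> within `[0, phi_h]%classic x^'] --> 0.
  rewrite -[X in _ --> X](mulr0 (derive_within `[0, phi_h]%classic f x)).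
  apply: cvgM; first exact: fx.
  rewrite -[X in _ --> X](subrr x); apply: cvgB; last exact: cvg_cst.
  apply: cvg_trans (cvg_within _) _.
  exact: cvg_within.
move/cvgr0Pnorm_lt/(_ _ eps0) : cvg_diff.
rewrite /within /dnbhs /within /prop_near1 /=.
apply: (@filterS _ (nbhs x)) => y fy_lt Dy.
have [->|yx] := eqVneq y x; first by rewrite subrr normr0.
by have := fy_lt yx Dy; rewrite divfK ?subr_eq0 // distrC.
Qed.

(** Multiplying the concavity inequality of [f] by the mean point [z] gives more than the chord of
    [g]: the excess of the products is [t * (1 - t) * ((x - y) * (f y - f x))], nonnegative because
    [f] decreases. *)
Lemma gross_revenue_concave : strictly_concave_on `[0, phi_h]%classic g.
Proof.
move=> x y t Dx Dy xy t01; have := f_concave x y t Dx Dy xy t01.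
have : 0 <= (x - y) * (f y - f x).
  have [xy'|yx|xy'] := ltgtP x y.
  - by rewrite mulr_le0 // subr_le0 ltW // f_decreasing.
  - by rewrite mulr_ge0 // subr_ge0 ltW // f_decreasing.
  - by rewrite xy' eqxx in xy.
move: t01 => /andP[t0 t1].
have [x0 y0] : 0 <= x /\ 0 <= y.
  by move: Dx Dy; rewrite /= !in_itv /= => /andP[-> _] /andP[-> _].
rewrite /gross_revenue; set z := t * x + (1 - t) * y.
(* As [x] and [y] are nonnegative, [z = 0] would force both to vanish, against [x != y]. *)
have z0 : 0 < z.
  rewrite lt0r; apply/andP; split; last by rewrite addr_ge0 ?mulr_ge0 //; lra.
  apply/negP => /eqP z0; move/eqP : xy; apply.
  have : t * x = 0 by move: z0; rewrite /z; nra.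
  have : (1 - t) * y = 0 by move: z0; rewrite /z; nra.
  by move=> /eqP; rewrite mulf_eq0 => /orP[|] /eqP ? /eqP;
     rewrite mulf_eq0 => /orP[|] /eqP ?; lra.
move=> H1 H2; rewrite -(ltr_pM2l z0) in H2.
apply: le_lt_trans H2; rewrite -subr_ge0.
have -> : z * (t * f x + (1 - t) * f y) - (t * (x * f x) + (1 - t) * (y * f y))
    = t * (1 - t) * ((x - y) * (f y - f x)) by rewrite /z; ring.
by rewrite mulr_ge0 // mulr_ge0 ?subr_ge0 // ltW.
Qed.

(** The slope of [g] equals [f x + y * ((f y - f x) / (y - x))]. Left slopes are used because they
    stay inside the segment even at [phi_h]. *)
Lemma cvg_left_slope (x : R) : 0 < x <= phi_h ->
  (g y - g x) / (y - x) @[y --> x^'-] --> d_m phi_h f x.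
Proof.
move=> /andP[x0 xh].
have Dx : x \in `[0, phi_h] by rewrite in_itv /= ltW.
have cvg_f : (f y - f x) / (y - x) @[y --> x^'-]
    --> derive_within `[0, phi_h]%classic f x.
  apply: cvg_trans (f_derivable x Dx) => P.
  rewrite /nbhs /= /at_left /dnbhs /within /nbhs /= => near_P.
  have y_gt0 : \forall y \near x, 0 < y by exact: lt_nbhsr.
  move: near_P; apply: (@filterS2 _ (nbhs x) _ _ _ _ _ y_gt0) => y y0 Py yx.
  apply: Py; first by rewrite lt_eqF.
  by rewrite /= in_itv /= ltW //= ltW // (lt_le_trans yx).
have : f x + y * ((f y - f x) / (y - x)) @[y --> x^'-] --> d_m phi_h f x.
  apply: cvgD; first exact: cvg_cst.
  by apply: cvgM => //; exact: cvg_within.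
apply: cvg_trans; apply: near_eq_cvg; near=> y.
have yx : y < x by [].
by rewrite /gross_revenue; field; rewrite subr_eq0 lt_eqF.
Unshelve. all: by end_near.
Qed.

(** The maximizer [p] of [g] is the largest point where [d_m] is nonnegative: left slopes at [p] are
    nonnegative, and by concavity those at any [x > p] are at most the negative slope of the chord
    from [p] to [x]. *)
Lemma gross_revenue_max : exists p,
  [/\ d_m_nonneg phi_h f p, ubound (d_m_nonneg phi_h f) p &
      forall x, x \in `[0, phi_h] -> x != p -> g x < g p].
Proof.
have g_cont : {within `[0, phi_h], continuous g}.
  apply/subspace_continuousP => x Dx.
  apply: cvgM; first exact: cvg_within.
  by have /subspace_continuousP := continuous_within_demand; exact.
have [p Dp p_max] := EVT_max (ltW phi_h_gt0) g_cont.
have [h0 hh] : 0 \in `[0, phi_h] /\ phi_h \in `[0, phi_h].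
  by rewrite !in_itv /= !lexx ltW.
have p_lt x : x \in `[0, phi_h] -> x != p -> g x < g p.
  move=> Dx xp; rewrite lt_neqAle p_max // andbT; apply/negP => /eqP gxp.
  (* Between two maximizers, strict concavity would make the midpoint strictly better. *)
  have between a b : a \in `[0, phi_h] -> b \in `[0, phi_h] -> a < b ->
      g a = g p -> g b = g p -> False.
    move=> Da Db ab ga gb; have [m1 m2] := midf_lt ab.
    have := strictly_concave_min_lt _ _ a ((a + b) / 2) b
      gross_revenue_concave Da Db.
    rewrite m1 m2 ga gb minxx => /(_ isT); apply/negP; rewrite -leNgt p_max //.
    move: Da Db; rewrite !in_itv /= => /andP[a0 _] /andP[_ bh].
    by rewrite (le_trans a0 (ltW m1)) (le_trans (ltW m2)).
  have [xp'|px|xp'] := ltgtP x p.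
  - exact: (between x p).
  - exact: (between p x).
  - by rewrite xp' eqxx in xp.
(* [g] vanishes at 0 and is positive at [phi_h]; hence [p] has a left neighbourhood in the
   segment. *)
have p_gt0 : 0 < p.
  move: (Dp); rewrite in_itv /= => /andP[p0 _]; rewrite lt_neqAle p0 andbT.
  apply: contraTneq (p_max _ hh) => <-; rewrite -ltNge.
  rewrite /gross_revenue mul0r mulr_gt0 //.
  by have /andP[] := f_range _ hh.
have ph : p <= phi_h by move: Dp; rewrite in_itv => /andP[].
exists p; split => //.
- split => //.
  have p0h : 0 < p <= phi_h by rewrite p_gt0.
  apply: (cvgr_to_ge (cvg_left_slope p p0h)); near=> y.
  have yp : y < p by [].
  have y0 : 0 < y by near: y; exact: nbhs_left_gt.
  rewrite mulr_le0 ?invr_le0 ?subr_le0 ?(ltW yp) // p_max //.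
  by rewrite in_itv /= !ltW // (lt_le_trans yp).
move=> x [Dx dx]; rewrite leNgt; apply/negP => px.
have xp : x != p by rewrite gt_eqF.
have gxp := p_lt x Dx xp.
have x0h : 0 < x <= phi_h.
  by rewrite (lt_trans p_gt0 px); move: Dx; rewrite in_itv => /andP[].
suff : d_m phi_h f x <= - ((g p - g x) / (x - p)).
  apply/negP; rewrite -ltNge (lt_le_trans _ dx) // oppr_lt0.
  by rewrite divr_gt0 ?subr_gt0.
apply: (cvgr_to_le (cvg_left_slope x x0h)); near=> y.
have yx : y < x by [].
have py : p < y by near: y; exact: nbhs_left_gt.
(* The weight that writes [y] as [t * p + (1 - t) * x]. *)
pose t := (x - y) / (x - p).
have xp0 : 0 < x - p by rewrite subr_gt0.
have xy0 : 0 < x - y by rewrite subr_gt0.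
have t01 : 0 < t < 1.
  by rewrite divr_gt0 //= ltr_pdivrMr // mul1r ltrD2l ltrN2.
have := gross_revenue_concave p x t Dp Dx _ t01.
rewrite eq_sym xp => /(_ isT).
have -> : t * p + (1 - t) * x = y by rewrite /t; field; rewrite gt_eqF.
move=> H.
have -> : (g y - g x) / (y - x) = - ((g y - g x) / (x - y)).
  by rewrite -[y - x]opprB invrN mulrN.
rewrite lerN2 ler_pdivlMr //.
have -> : (g p - g x) / (x - p) * (x - y) = t * (g p - g x).
  by rewrite /t; ring.
lra.
Unshelve. all: by end_near.
Qed.

(** * The optimal price in the limit regime *)

Lemma ext_inverse_spec (c : R) : c <= 1 ->
  [/\ ext_inverse phi_h f c \in `[0, phi_h], c <= f (ext_inverse phi_h f c) &
      (ext_inverse phi_h f c < phi_h -> f (ext_inverse phi_h f c) = c)].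
Proof.
move=> c1; rewrite /ext_inverse; case: ltP => [cf|fc].
  by rewrite in_itv /= lexx ltW // ltxx; split => //; exact: ltW.
rewrite ltNge c1 /=.
(* A preimage exists since [f phi_h <= c <= f 0], so [xget] does not fall back on its default. *)
have [x Dx fx] : exists2 x, x \in `[0, phi_h] & f x = c.
  apply: (IVT (ltW phi_h_gt0) continuous_within_demand).
  by rewrite f_at0 ge_min le_max fc c1 orbT.
have [] : [set phi | phi \in `[0, phi_h] /\ f phi = c]
    (xget 0 [set phi | phi \in `[0, phi_h] /\ f phi = c]).
  by apply: xgetPex; exists x.
by move=> Dq ->; split.
Qed.

Lemma le_price (x y : R) : x \in `[0, phi_h] -> y \in `[0, phi_h] ->
  f x <= f y -> y <= x.
Proof.
move=> Dx Dy fxy; rewrite leNgt; apply/negP => xy.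
by have := f_decreasing _ _ Dx Dy xy; rewrite ltNge fxy.
Qed.

(* The unique optimal price at [beta = 0] for [e / Lambda = r], [p] being the
   maximizer of [x * f x]. *)
Definition optimal_price (p r : R) : R :=
  if r <= f p / 2 then ext_inverse phi_h f (2 * r) else p.

Lemma revenue0_gross (Lambda e x : R) : 0 < Lambda -> x \in `[0, phi_h] ->
  revenue0 f Lambda e x = Num.min (e * x) (Lambda / 2 * g x).
Proof.
move=> L0 Dx; rewrite revenue0E //; last first.
  by move: Dx; rewrite in_itv => /andP[].
by rewrite /gross_revenue -mulrA (mulrC (f x)).
Qed.

Section GrossMaximizer.
Context (p : R).
Hypotheses (Dp : p \in `[0, phi_h])
  (p_lt : forall x, x \in `[0, phi_h] -> x != p -> g x < g p).

Let le1 (r : R) : r <= f p / 2 -> 2 * r <= f p.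
Proof. lra. Qed.

Let fp1 : f p <= 1. Proof. by have /andP[] := f_range _ Dp. Qed.

Lemma le_ext_inverse (r : R) : r <= f p / 2 -> p <= ext_inverse phi_h f (2 * r).
Proof.
move=> /le1 rp; have [Dq _ fq] := ext_inverse_spec (2 * r) (le_trans rp fp1).
move: (Dq); rewrite in_itv /= => /andP[_]; rewrite le_eqVlt => /orP[/eqP->|qh].
  by move: Dp; rewrite in_itv /= => /andP[].
by apply: le_price; rewrite // fq.
Qed.

(** Inside the first regime this is the monotonicity of [f]. Increasing the ratio can only lead from
    the first regime to the second, where the price drops to [p], a lower bound of the first. *)
Lemma optimal_price_nonincreasing (r s : R) : r <= s ->
  optimal_price p s <= optimal_price p r.
Proof.
move=> rs; rewrite /optimal_price.
case: (leP s) => [sp|ps]; case: (leP r) => [rp|pr] //.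
- have [Dr _ fr] := ext_inverse_spec (2 * r) (le_trans (le1 _ rp) fp1).
  have [Ds fs _] := ext_inverse_spec (2 * s) (le_trans (le1 _ sp) fp1).
  move: (Dr); rewrite in_itv /= => /andP[_].
  rewrite le_eqVlt => /orP[/eqP->|qh].
    by move: Ds; rewrite in_itv /= => /andP[].
  by apply: le_price; rewrite // fr // (le_trans _ fs) // ler_pM2l.
- by move: (lt_le_trans pr rs); rewrite ltNge sp.
- exact: le_ext_inverse.
Qed.

Lemma revenue0_lt_optimal (Lambda e x : R) : 0 < Lambda -> 0 < e ->
  x \in `[0, phi_h] -> x != optimal_price p (e / Lambda) ->
  revenue0 f Lambda e x < revenue0 f Lambda e (optimal_price p (e / Lambda)).
Proof.
move=> L0 e0 Dx.
have L20 : 0 < Lambda / 2 by rewrite divr_gt0.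
rewrite /optimal_price; case: (leP (e / Lambda)) => [rp|pr] xq; last first.
  rewrite !revenue0_gross //.
  have -> : Num.min (e * p) (Lambda / 2 * g p) = Lambda / 2 * g p.
    rewrite min_r // /gross_revenue.
    have p0 : 0 <= p by move: Dp; rewrite in_itv => /andP[].
    (* In this form the two branches are compared through [f p] and [2 * (e / Lambda)]. *)
    have -> : e * p = Lambda / 2 * (p * (2 * (e / Lambda))).
      by field; rewrite gt_eqF.
    by rewrite ler_pM2l // ler_wpM2l //; lra.
  by rewrite gt_min ltr_pM2l // p_lt // orbT.
have [Dq fq fqE] := ext_inverse_spec _ (le_trans (le1 _ rp) fp1).
have pq := le_ext_inverse _ rp; move: xq Dq fq fqE pq.
set q := ext_inverse _ _ _ => xq Dq fq fqE pq.
have q0 : 0 <= q by move: Dq; rewrite in_itv => /andP[].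
have eE : e = Lambda / 2 * (2 * (e / Lambda)) by field; rewrite gt_eqF.
rewrite !revenue0_gross //.
have -> : Num.min (e * q) (Lambda / 2 * g q) = e * q.
  rewrite min_l // {1}eE -mulrA ler_pM2l // /gross_revenue.
  by rewrite [q * _]mulrC ler_wpM2r.
rewrite gt_min; have [xltq|qx|xq'] := ltgtP x q.
- by rewrite ltr_pM2l // xltq.
- apply/orP; right.
  (* A price above [q] excludes truncation at [phi_h], so [f q] is exactly [2 * (e / Lambda)] and
     the two branches agree at [q]. *)
  have qh : q < phi_h.
    by apply: (lt_le_trans qx); move: Dx; rewrite in_itv => /andP[].
  have -> : e * q = Lambda / 2 * g q.
    by rewrite {1}eE /gross_revenue fqE //; ring.
  rewrite ltr_pM2l //.
  (* Either [q] is the maximizer [p] of [g], or it lies strictly between [p] and [x], and strict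
     concavity gives [g x < g q]. *)
  move: pq; rewrite le_eqVlt => /orP[/eqP pq|pq].
    by rewrite -pq p_lt // pq gt_eqF.
  have gxp : g x < g p by rewrite p_lt // gt_eqF // (lt_trans pq).
  have := strictly_concave_min_lt _ _ p q x gross_revenue_concave Dp Dx.
  by rewrite pq qx (min_r (ltW gxp)); exact.
- by rewrite xq' eqxx in xq.
Qed.

Lemma optimal_price_itv (r : R) : optimal_price p r \in `[0, phi_h].
Proof.
rewrite /optimal_price; case: leP => // rp.
by have [] := ext_inverse_spec _ (le_trans (le1 _ rp) fp1).
Qed.

Lemma argmax_revenue0 (Lambda e : R) : 0 < Lambda -> 0 < e ->
  argmax `[0, phi_h]%classic (revenue0 f Lambda e)
    = [set optimal_price p (e / Lambda)].
Proof.
move=> L0 e0; apply/seteqP; split => x /=.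
  move=> [Dx x_max]; apply/eqP; apply: contraT => xq.
  have := x_max _ (optimal_price_itv (e / Lambda)).
  by rewrite leNgt revenue0_lt_optimal.
move=> ->; split; first exact: optimal_price_itv.
move=> y Dy; have [->//|yq] := eqVneq y (optimal_price p (e / Lambda)).
by rewrite ltW // revenue0_lt_optimal.
Qed.
End GrossMaximizer.

(** One branch is increasing and the other concave; each is quasi-concave, and so is their
    minimum. *)
Lemma revenue0_quasiconcave (Lambda e a z b : R) : 0 < Lambda -> 0 < e ->
  a \in `[0, phi_h] -> b \in `[0, phi_h] -> a <= z <= b ->
  Num.min (revenue0 f Lambda e a) (revenue0 f Lambda e b)
    <= revenue0 f Lambda e z.
Proof.
move=> L0 e0 Da Db /andP[]; rewrite le_eqVlt => /orP[/eqP->|az].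
  by rewrite ge_min lexx.
rewrite le_eqVlt => /orP[/eqP->|zb]; first by rewrite ge_min lexx orbT.
have Dz : z \in `[0, phi_h].
  move: Da Db; rewrite !in_itv /= => /andP[a0 _] /andP[_ bh].
  by rewrite (le_trans a0 (ltW az)) (le_trans (ltW zb)).
have L20 : 0 < Lambda / 2 by rewrite divr_gt0.
have := strictly_concave_min_lt _ _ a z b gross_revenue_concave Da Db.
rewrite az zb => /(_ isT) /ltW; rewrite -(ler_pM2l L20) => H.
rewrite !revenue0_gross // le_min; apply/andP; split.
  by rewrite !ge_min ler_pM2l // (ltW az).
by apply: le_trans H; rewrite minr_pMr ?(ltW L20) // le_min !ge_min !lexx !orbT.
Qed.
End Revenue.

(** * Convergence of optimal prices *)

Lemma cvg_argmax_quasiconcave {R : realType} (D : set R) (u : R -> R)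
    (v : nat -> R -> R) (q : R) (x : nat -> R) :
  (forall a z b, D a -> D b -> a <= z <= b -> D z) ->
  (forall a z b, D a -> D b -> a <= z <= b -> Num.min (u a) (u b) <= u z) ->
  argmax D u = [set q] ->
  (forall n y, D y -> v n y <= u y) ->
  v n q @[n --> \oo] --> u q ->
  (forall n, argmax D (v n) (x n)) ->
  x n @[n --> \oo] --> q.
Proof.
move=> D_conv u_qc u_max v_le v_q x_max; apply/cvgrPdist_lt => eps eps0.
have [Dq q_max] : argmax D u q by rewrite u_max.
have q_lt y : D y -> y != q -> u y < u q.
  move=> Dy /eqP yq; rewrite lt_neqAle q_max // andbT; apply/eqP => uyq.
  apply: yq; rewrite -[_ = _]/([set q] y) -u_max; split => // z Dz.
  by rewrite uyq q_max.
(* Quasi-concavity bounds [u] beyond [s] by [u s]. If [s] is outside [D], convexity leaves no point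
   of [D] beyond it, so any bound below [u q] serves, here [u q - 1]. *)
have side (s : R) : s != q -> exists2 m, m < u q & forall y, D y ->
    (y <= s <= q) || (q <= s <= y) -> u y <= m.
  move=> sq; have [Ds|nDs] := pselect (D s).
    exists (u s); first exact: q_lt.
    move=> y Dy /orP[H|H].
      by have := u_qc _ _ _ Dy Dq H; rewrite min_l // q_max.
    by have := u_qc _ _ _ Dq Dy H; rewrite min_r // q_max.
  exists (u q - 1); first by rewrite ltrBlDr ltrDl.
  by move=> y Dy /orP[H|H]; exfalso; apply: nDs; exact: D_conv H.
have [m1 m1q H1] : exists2 m, m < u q & forall y, D y ->
    (y <= q - eps <= q) || (q <= q - eps <= y) -> u y <= m.
  by apply: side; rewrite lt_eqF // ltrBlDr ltrDl.
have [m2 m2q H2] : exists2 m, m < u q & forall y, D y ->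
    (y <= q + eps <= q) || (q <= q + eps <= y) -> u y <= m.
  by apply: side; rewrite gt_eqF // ltrDl.
have m_lt : Num.max m1 m2 < u q by rewrite gt_max m1q.
near=> n; have [Dx xn_max] := x_max n.
(* Eventually [v n q] exceeds both bounds, and [v n q <= v n (x n) <= u (x n)]. *)
have : Num.max m1 m2 < u (x n).
  apply: lt_le_trans (v_le _ _ Dx); apply: lt_le_trans (xn_max _ Dq).
  by near: n; exact: cvgr_gt v_q _ m_lt.
rewrite gt_max => /andP[ux1 ux2].
rewrite ltr_distlC; apply/andP; split; rewrite ltNge; apply/negP => H.
  by move: ux1; apply/negP; rewrite -leNgt H1 // H gerBl ltW.
by move: ux2; apply/negP; rewrite -leNgt H2 // lerDl (ltW eps0) H orbT.
Unshelve. all: by end_near.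
Qed.

Theorem theorem1 (R : realType) (phi_h : R) (f : R -> R)
    (phi_h_gt0 : 0 < phi_h)
    (f_concave : strictly_concave_on `[0, phi_h]%classic f)
    (f_decreasing : forall x y : R, x \in `[0, phi_h] -> y \in `[0, phi_h] ->
       x < y -> f y < f x)
    (f_derivable : forall x : R, x \in `[0, phi_h] ->
       derivable_within `[0, phi_h]%classic f x)
    (f_range : forall x : R, x \in `[0, phi_h] -> 0 < f x <= 1)
    (f_at0 : f 0 = 1)
    (Lambda e : R) (Lambda_gt0 : 0 < Lambda) (e_gt0 : 0 < e) :
  let rho := e / Lambda in
  let phi_m := sup (d_m_nonneg phi_h f) in
  (* phi_m is a maximum *)
  (d_m_nonneg phi_h f phi_m /\ ubound (d_m_nonneg phi_h f) phi_m) /\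
  (* revenue0 is the pointwise limit of the revenue as beta decreases to 0 *)
  (forall phi : R, phi \in `[0, phi_h] ->
     revenue f Lambda e phi beta @[beta --> 0^'+]
       --> revenue0 f Lambda e phi) /\
  (rho <= f phi_m / 2 ->
     argmax `[0, phi_h]%classic (revenue0 f Lambda e)
       = [set ext_inverse phi_h f (2 * rho)]) /\
  (f phi_m / 2 < rho ->
     argmax `[0, phi_h]%classic (revenue0 f Lambda e) = [set phi_m]) /\
  (* price r is the unique optimal price whenever the ratio e / Lambda is r *)
  (exists price : R -> R,
     (forall r s : R, 0 < r -> r <= s -> price s <= price r) /\
     (forall Lambda' e' : R, 0 < Lambda' -> 0 < e' ->
        argmax `[0, phi_h]%classic (revenue0 f Lambda' e')
          = [set price (e' / Lambda')]) /\
     (forall beta phi_opt : nat -> R,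
        (forall n, 0 < beta n) ->
        beta n @[n --> \oo] --> (0 : R) ->
        (forall n, argmax `[0, phi_h]%classic
                     (fun phi => revenue f Lambda e phi (beta n)) (phi_opt n)) ->
        exists sigma : nat -> nat,
          increasing_seq sigma /\
          phi_opt (sigma n) @[n --> \oo] --> price rho)).
Proof.
move=> rho phi_m.
have [p [dp p_ub p_lt]] := gross_revenue_max phi_h f phi_h_gt0 f_concave
  f_decreasing f_derivable f_range.
(* The supremum is attained: [p] belongs to the set and bounds it. *)
have -> : phi_m = p.
  apply/eqP; rewrite eq_le sup_ubound ?andbT; last exact: dp.
    by apply: sup_le_ub => //; exists p.
  by exists p.
have Dp := dp.1.
have argmaxE Lambda' e' : 0 < Lambda' -> 0 < e' ->
    argmax `[0, phi_h]%classic (revenue0 f Lambda' e')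
      = [set optimal_price phi_h f p (e' / Lambda')].
  exact: argmax_revenue0.
have D_ge0 x : x \in `[0, phi_h] -> 0 <= x by rewrite in_itv => /andP[].
have f_gt0 x : x \in `[0, phi_h] -> 0 < f x by move=> /f_range/andP[].
have revenue_cvg phi : phi \in `[0, phi_h] ->
    revenue f Lambda e phi beta @[beta --> 0^'+] --> revenue0 f Lambda e phi.
  by move=> Dphi; apply: cvg_revenue; auto.
split; first by [].
split; first exact: revenue_cvg.
split; first by move=> rp; rewrite argmaxE // /optimal_price -/rho rp.
split; first by move=> pr; rewrite argmaxE // /optimal_price -/rho leNgt pr.
exists (optimal_price phi_h f p); split; last split; last first.
- move=> beta phi_opt beta_gt0 beta_cvg phi_optP; exists id; split=> //.
  apply: (cvg_argmax_quasiconcave `[0, phi_h]%classic (revenue0 f Lambda e)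
    (fun n phi => revenue f Lambda e phi (beta n))) => //.
  + move=> a z b /=; rewrite !in_itv /= => /andP[a0 _] /andP[_ bh].
    by move=> /andP[az zb]; rewrite (le_trans a0 az) (le_trans zb bh).
  + by move=> a z b; exact: revenue0_quasiconcave.
  + exact: argmaxE.
  + by move=> n y Dy; apply: revenue_le_revenue0; auto.
  have Dq : optimal_price phi_h f p rho \in `[0, phi_h].
    exact: optimal_price_itv.
  (* The right-hand limit at 0 is read along the positive sequence [beta]. *)
  by have /cvg_at_rightP := revenue_cvg _ Dq; apply.
- exact: argmaxE.
by move=> r s _; exact: optimal_price_nonincreasing.
Qed.
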